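(* Let $a,b>0$, $s\in(0,1)$ and $\lambda>0$. Let $\eta$ have prior distribution $F_{a,b}=(1-s)\delta_1+s\,\Pi_{a,b}$, where $\Pi_{a,b}$ is the RSB distribution with density $\pi_{\rm RSB}(\cdot;a,b)$, and let $y\mid\eta\sim\mathrm{Po}(\eta\lambda)$. Define the posterior probability $$P_{a,b}(\varepsilon;\lambda):=\Pr(\eta<\varepsilon\mid y=0;a,b)=\frac{\int_{(0,\varepsilon)}e^{-\lambda\eta}\,F_{a,b}(d\eta)}{\int_{(0,\infty)}e^{-\lambda\eta}\,F_{a,b}(d\eta)}.$$ Then (i) for every $\varepsilon>0$, $\lambda\mapsto P_{a,b}(\varepsilon;\lambda)$ is non-decreasing on $(0,\infty)$; and (ii) if $0<a<1<a'<\infty$ and $s\in(0,1]$, then for every $\lambda>0$, $P_{a,b}(\varepsilon;\lambda)/P_{a',b}(\varepsilon;\lambda)\to\infty$ as $\varepsilon\to0$.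
   Context: For $a,b>0$, $\pi_{\rm RSB}(u;a,b)=\frac{1}{B(a,b)}\frac{\{\log(1+u)\}^{a-1}}{1+u}\frac{1}{\{1+\log(1+u)\}^{a+b}}$, $u>0$. $\delta_1$ is the point mass at $1$. $\mathrm{Po}(\mu)$ is the Poisson distribution with mean $\mu$, so the likelihood of $y=0$ given $\eta$ is $e^{-\lambda\eta}$. *)

(* Defs.v *)
From HB Require Import structures.
From mathcomp Require Import all_boot all_order all_algebra.
From mathcomp Require Import all_classical all_reals all_analysis.
Set Implicit Arguments. Unset Strict Implicit. Unset Printing Implicit Defensive.
Import Order.TTheory GRing.Theory Num.Theory.
Import numFieldNormedType.Exports.
Local Open Scope classical_set_scope.
Local Open Scope ring_scope.

Section Defs.
Variable R : realType.

Definition betaf (a b : R) : R :=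
  Rintegral (@lebesgue_measure R) `]0, 1[
    (fun t => t `^ (a - 1) * (1 - t) `^ (b - 1)).

Definition pi_rsb (a b u : R) : R :=
  (betaf a b)^-1 * (ln (1 + u)) `^ (a - 1) / (1 + u)
  / (1 + ln (1 + u)) `^ (a + b).

(* \int_D e^{-lam eta} F_{a,b}(d eta), with F_{a,b} = (1-s) delta_1 + s Pi_{a,b}
   and Pi_{a,b} having Lebesgue density pi_rsb on (0, oo). *)
Definition intF (s a b lam : R) (D : set R) : R :=
  (1 - s) * (\1_D 1 * expR (- lam * 1))
  + s * Rintegral (@lebesgue_measure R) (D `&` `]0, +oo[)
          (fun u => expR (- lam * u) * pi_rsb a b u).

Definition post (s a b eps lam : R) : R :=
  intF s a b lam `]0, eps[ / intF s a b lam `]0, +oo[.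

End Defs.

(* Main.v *)
Require Import Defs.
From HB Require Import structures.
From mathcomp Require Import all_boot all_order all_algebra.
From mathcomp Require Import all_classical all_reals all_analysis.
From mathcomp Require Import ring lra measurable_realfun.
Import Order.TTheory GRing.Theory Num.Theory.
Import numFieldNormedType.Exports.
Local Open Scope classical_set_scope.
Local Open Scope ring_scope.

(* Split the prior mass into its parts below and above eps. Raising lambda from
   l1 to l2 multiplies the integrand by exp (- (l2 - l1) u), which is at least
   exp (- (l2 - l1) eps) below eps and at most that above it, so the odds of
   {eta < eps} can only grow.  For the ratio, once eps <= 1 the atom at 1 is
   outside (0, eps), and pi_RSB(u; a, b) / pi_RSB(u; a', b) is at least a
   constant times ln (1 + u) ^ (a - a'), which tends to +oo at 0, so the same
   holds for the integrals over (0, eps).  Finiteness of all the integrals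
   comes from X = L / (1 + L), L = ln (1 + u), which carries pi_RSB to the
   beta density. *)

(** * Integrability from bounded antiderivatives, and strict positivity of integrals *)

(** The integrand may blow up at the ends of [A], so the fundamental theorem is applied only on each
    [[u n, v n]]. It bounds the integral there by [F (v n) - F (u n)], uniformly in [n], and
    monotone convergence carries the bound to [A]. *)
Lemma integrable_antiderivative_bounded (R : realType) (f F : R -> R) (M : R)
    (u v : nat -> R) (A : set R) :
  nonincreasing_seq u -> nondecreasing_seq v ->
  A = \bigcup_n `[u n, v n]%classic ->
  (forall x, A x -> [/\ 0 <= f x, {for x, continuous f},
     is_derive x 1 F (f x) & `|F x| <= M]) ->
  (@lebesgue_measure R).-integrable A (EFin \o f).
Proof.
move=> ud vi AE fF.
have uvA n x : u n <= x <= v n -> A x.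
  by move=> uxv; rewrite AE; exists n => //=; rewrite in_itv.
have mA : measurable A by rewrite AE; exact: bigcup_measurable.
have cf n : {within `[u n, v n], continuous f}.
  apply: continuous_in_subspaceT => x.
  by rewrite inE/= in_itv/= => /uvA /fF [].
have mf : measurable_fun A f.
  rewrite AE; apply/measurable_fun_bigcup => // n.
  by apply: subspace_continuous_measurable_fun => //; exact: cf.
apply/integrableP; split; first exact/measurable_EFinP.
have -> : (\int[lebesgue_measure]_(x in A) `|(EFin \o f) x| =
    \int[lebesgue_measure]_(x in \bigcup_n `[u n, v n]%classic) (f x)%:E)%E.
  rewrite -AE; apply: eq_integral => x; rewrite inE => /fF[f0 _ _ _].
  by rewrite /= ger0_norm.
have cvI : (\int[lebesgue_measure]_(x in `[u n, v n]) (f x)%:E @[n --> \oo] -->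
    \int[lebesgue_measure]_(x in \bigcup_n `[u n, v n]%classic) (f x)%:E)%E.
  apply: ge0_nondecreasing_set_cvg_integral => //.
  - move=> m n mn; rewrite subsetEset; apply: subset_itv; rewrite bnd_simp.
      exact: ud.
    exact: vi.
  - move=> n; apply/measurable_EFinP; apply: measurable_funS mf => // x /=.
    by rewrite in_itv/=; exact: uvA.
  - by move=> n x /=; rewrite in_itv/= => /uvA/fF[f0 _ _ _]; rewrite lee_fin.
rewrite -(cvg_lim _ cvI)//.
(* The absolute value keeps the bound nonnegative for those [n] where [[u n, v n]] is empty or a
   single point and the integral is 0. Such [n] do occur in the exhaustions used below. *)
apply: (@le_lt_trans _ _ (`|M| *+ 2)%:E); last exact: ltry.
apply: lime_le; first by apply/cvg_ex; eexists; exact: cvI.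
apply: nearW => n.
have [vu|] := ltP (v n) (u n).
  by rewrite set_itv_ge ?integral_set0 ?lee_fin ?mulrn_wge0// bnd_simp -ltNge.
rewrite le_eqVlt => /predU1P[uv|uv].
  by rewrite uv set_itv1 integral_set1 lee_fin mulrn_wge0.
have cF x : u n <= x <= v n -> {for x, continuous F}.
  move=> /uvA/fF[_ _ [dF _] _]; apply: differentiable_continuous.
  exact/derivable1_diffP.
rewrite (@continuous_FTC2 _ f F) //.
- have := ler_norm M.
  have [] := fF _ (uvA n (u n) ltac:(by rewrite lexx ltW)) => _ _ _.
  have [] := fF _ (uvA n (v n) ltac:(by rewrite lexx ltW)) => _ _ _.
  by rewrite -EFinB lee_fin mulr2n !ler_norml; lra.
- split.
  + move=> x; rewrite in_itv/= => /andP[ux xv].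
    by have [_ _ []] := fF _ (uvA n x ltac:(by rewrite !ltW)).
  + by apply: cvg_at_right_filter; apply: cF; rewrite lexx ltW.
  + by apply: cvg_at_left_filter; apply: cF; rewrite lexx ltW.
- move=> x; rewrite in_itv/= => /andP[ux xv].
  have [_ _ dF _] := fF _ (uvA n x ltac:(by rewrite !ltW)).
  by rewrite derive1E; exact: derive_val.
Qed.

(** If the integral were 0, [f] would vanish almost everywhere, and the interval, on which [f] is
    positive, would lie in a null set although its length is positive. Integrability matters:
    [Rintegral] gives an infinite integral the value 0. *)
Lemma Rintegral_itvoo_gt0 (R : realType) (f : R -> R) (p : R) (q : itv_bound R) :
  (BRight p < q)%O ->
  (@lebesgue_measure R).-integrable [set` Interval (BRight p) q] (EFin \o f) ->
  (forall x, x \in Interval (BRight p) q -> 0 < f x) ->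
  0 < Rintegral (@lebesgue_measure R) [set` Interval (BRight p) q] f.
Proof.
move=> pq intf f0; set I : set R := [set` _] in intf *.
have mI : measurable I by exact: measurable_itv.
rewrite lt_neqAle Rintegral_ge0 ?andbT; last by move=> x /f0/ltW.
apply/eqP => /esym If0.
have /(ae_eq_integral_abs lebesgue_measure mI (measurable_int _ intf)) :
    (\int[lebesgue_measure]_(x in I) `|(EFin \o f) x| = 0)%E.
  rewrite -[RHS]/(0%:E) -If0 /Rintegral fineK; last exact: integrable_fin_num.
  by apply: eq_integral => x; rewrite inE /= => /f0 fx0; rewrite gtr0_norm.
move=> [N [mN N0 fN]].
have : (lebesgue_measure I <= lebesgue_measure N)%E.
  apply: le_measure; rewrite ?inE// => x Ix; apply: fN => /= /(_ Ix)[fx0].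
  by have := f0 _ Ix; rewrite fx0 ltxx.
rewrite N0 leNgt lebesgue_measure_itv/=.
case: q pq {f0 intf mI If0 fN} @I => [b q|[]]/=.
- by case: b; rewrite bnd_simp => pq;
    rewrite lte_fin pq -EFinB lte_fin subr_gt0 pq.
- by rewrite bnd_simp.
- by rewrite ltry addye// ltry.
Qed.

(** * Integrals of beta type under a change of variable *)

(** The power is monotone in [x]: for [1 <= c] it is largest at 1, otherwise at 1/2. Adding the two
    extreme values avoids a case split in later uses. *)
Lemma powR_sub1_le (R : realType) (c x : R) : 2^-1 <= x -> x <= 1 ->
  x `^ (c - 1) <= 1 + 2^-1 `^ (c - 1).
Proof.
move=> x2 x1; have x0 : 0 < x by apply: lt_le_trans x2; rewrite invr_gt0.
have [c1|c1] := leP 1 c.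
  apply: (@le_trans _ _ 1); last by rewrite lerDl powR_ge0.
  have := @ge0_ler_powR _ (c - 1) ltac:(by rewrite subr_ge0) x 1.
  by rewrite !nnegrE powR1; apply => //; exact: ltW.
apply: (@le_trans _ _ (2^-1 `^ (c - 1))); last by rewrite lerDr.
rewrite -[c - 1]opprK [leLHS]powRN [leRHS]powRN lef_pV2 ?posrE ?powR_gt0//.
have := @ge0_ler_powR _ (- (c - 1)) ltac:(by rewrite oppr_ge0 subr_le0 ltW) 2^-1 x.
by rewrite !nnegrE invr_ge0; apply => //; exact: ltW.
Qed.

(* With [p = X `^ (a - 1)] and [q = (1 - X) `^ (b - 1)], one of [p], [q] is
   bounded according to the position of [X] relative to 1/2, so
   [p * q * X' <= K * (p * X' + q * X')], and both terms on the right have the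
   bounded antiderivatives [X `^ a / a] and [- (1 - X) `^ b / b]. *)
Lemma integrable_beta_comp (R : realType) (a b : R) (X X' : R -> R)
    (u v : nat -> R) (A : set R) :
  0 < a -> 0 < b ->
  nonincreasing_seq u -> nondecreasing_seq v ->
  A = \bigcup_n `[u n, v n]%classic ->
  (forall x, A x -> [/\ 0 < X x < 1, 0 <= X' x, {for x, continuous X'} &
     is_derive x 1 X (X' x)]) ->
  measurable_fun A X -> measurable_fun A X' ->
  (@lebesgue_measure R).-integrable A
    (EFin \o (fun x => X x `^ (a - 1) * (1 - X x) `^ (b - 1) * X' x)).
Proof.
move=> a0 b0 ud vi AE XA mX mX'.
have mA : measurable A by rewrite AE; exact: bigcup_measurable.
have cX x : A x -> {for x, continuous X}.
  move=> /XA[_ _ _ [dX _]]; apply: differentiable_continuous.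
  exact/derivable1_diffP.
have cpow c (Y : R -> R) x : 0 < Y x -> {for x, continuous Y} ->
    {for x, continuous (fun t => Y t `^ c)}.
  move=> Y0 cY; apply: (@continuous_comp _ _ _ Y (@powR R ^~ c)) => //.
  apply: differentiable_continuous; apply/derivable1_diffP.
  by apply: derivable_powR; rewrite in_itv/= Y0.
have intl : (@lebesgue_measure R).-integrable A
    (EFin \o (fun x => X x `^ (a - 1) * X' x)).
  apply: (@integrable_antiderivative_bounded _ _ (fun x => a^-1 * X x `^ a)
    a^-1 u v) => // x Ax.
  have [/andP[X0 X1] X'0 cX' dX] := XA _ Ax; split.
  - by rewrite mulr_ge0 ?powR_ge0.
  - by apply: continuousM => //; apply: cpow => //; exact: cX.
  - have dp := is_derive1_powR a X0.
    have dc := is_derive1_comp dp dX.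
    have -> : X x `^ (a - 1) * X' x = a^-1 *: (a * X x `^ (a - 1) * X' x).
      by rewrite -[RHS]/(a^-1 * _) -mulrA mulKf ?gt_eqF.
    exact: is_deriveZ.
  - rewrite ger0_norm ?mulr_ge0 ?powR_ge0 ?invr_ge0 ?(ltW a0)//.
    rewrite ler_piMr ?invr_ge0 ?(ltW a0)//.
    have := @ge0_ler_powR _ a (ltW a0) (X x) 1.
    by rewrite !nnegrE powR1; apply => //; exact: ltW.
have intr : (@lebesgue_measure R).-integrable A
    (EFin \o (fun x => (1 - X x) `^ (b - 1) * X' x)).
  apply: (@integrable_antiderivative_bounded _ _
    (fun x => (- b^-1) * (1 - X x) `^ b) b^-1 u v) => // x Ax.
  have [/andP[X0 X1] X'0 cX' dX] := XA _ Ax.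
  have Y0 : 0 < 1 - X x by rewrite subr_gt0.
  split.
  - by rewrite mulr_ge0 ?powR_ge0.
  - apply: continuousM => //; apply: (cpow _ (fun t => 1 - X t)) => //.
    by apply: continuousB; [exact: cst_continuous|exact: cX].
  - have dY : is_derive x 1 (fun t => 1 - X t) (- X' x).
      by rewrite -[- X' x]sub0r; exact: is_deriveB.
    have dc := @is_derive1_comp _ (@powR R ^~ b) (fun t => 1 - X t) x _ _
      (is_derive1_powR b Y0) dY.
    have -> : (1 - X x) `^ (b - 1) * X' x =
        (- b^-1) *: (b * (1 - X x) `^ (b - 1) * (- X' x)).
      rewrite -[RHS]/(- b^-1 * _) mulrN mulNr mulrN opprK -mulrA mulKf//.
      by rewrite gt_eqF.
    exact: is_deriveZ.
  - rewrite normrM normrN !ger0_norm ?powR_ge0 ?invr_ge0 ?(ltW b0)//.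
    rewrite ler_piMr ?invr_ge0 ?(ltW b0)//.
    have := @ge0_ler_powR _ b (ltW b0) (1 - X x) 1.
    by rewrite !nnegrE powR1; apply => //; lra.
(* One summand bounds the [(1 - X)] power when [X < 1/2], the other the [X] power when [1/2 <= X];
   the sum covers both cases. *)
pose K : R := (1 + 2^-1 `^ (b - 1)) + (1 + 2^-1 `^ (a - 1)).
have intK := integrableZl (mu := lebesgue_measure) mA K
  (integrableD (mu := lebesgue_measure) mA intl intr).
apply: le_integrable intK => //.
  apply/measurable_EFinP; apply: measurable_funM => //.
  apply: measurable_funM.
    exact: (measurableT_comp (measurable_powR _)).
  apply: (measurableT_comp (measurable_powR _)).
  exact: measurable_funB.
move=> x Ax; have [/andP[X0 X1] X'0 _ _] := XA _ Ax.
have p0 c : 0 <= (2^-1 : R) `^ c by exact: powR_ge0.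
rewrite /= lee_fin normrM !ger0_norm ?mulr_ge0 ?addr_ge0 ?mulr_ge0 ?powR_ge0//.
rewrite -mulrDl mulrA ler_wpM2r//.
set P := X x `^ (a - 1); set Q := (1 - X x) `^ (b - 1).
have P0 : 0 <= P by exact: powR_ge0.
have Q0 : 0 <= Q by exact: powR_ge0.
have [x2|x2] := leP 2^-1 (X x).
- have := powR_sub1_le _ a _ x2 (ltW X1); rewrite -/P => PK.
  apply: (@le_trans _ _ ((1 + 2^-1 `^ (a - 1)) * Q)); first exact: ler_wpM2r.
  apply: ler_pM => //; rewrite ?addr_ge0// /K ?lerDr ?lerDl ?addr_ge0//.
- have := powR_sub1_le _ b (1 - X x) ltac:(lra) ltac:(lra); rewrite -/Q => QK.
  rewrite mulrC.
  apply: (@le_trans _ _ ((1 + 2^-1 `^ (b - 1)) * P)); first exact: ler_wpM2r.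
  apply: ler_pM => //; rewrite ?addr_ge0// /K ?lerDr ?lerDl ?addr_ge0//.
Qed.

Lemma invS_le_eventually (R : realType) (x : R) : 0 < x ->
  exists N, forall n, (N <= n)%N -> n.+1%:R^-1 <= x.
Proof.
move=> x0; exists (Num.bound x^-1) => n Nn.
rewrite -[x]invrK lef_pV2 ?posrE ?invr_gt0//.
have xN := archi_boundP (ltW (ltac:(by rewrite invr_gt0) : 0 < x^-1)).
apply/ltW/(lt_le_trans xN); rewrite ler_nat; exact: leq_trans Nn _.
Qed.

Lemma nonincreasing_invS (R : realType) :
  nonincreasing_seq (fun n => n.+1%:R^-1 : R).
Proof.
by move=> m n mn; rewrite lef_pV2 ?posrE ?ltr0n// ler_nat.
Qed.

Lemma itv01_bigcup (R : realType) :
  `]0, 1[%classic = \bigcup_n `[n.+1%:R^-1, 1 - n.+1%:R^-1]%classic :> set R.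
Proof.
apply/seteqP; split => x /=; rewrite ?in_itv/=.
- move=> /andP[x0 x1]; have [N HN] := invS_le_eventually _ _ x0.
  have [N' HN'] := invS_le_eventually R (1 - x) ltac:(by rewrite subr_gt0).
  exists (maxn N N') => //=; rewrite in_itv/= HN ?leq_maxl//=.
  by rewrite lerBrDr addrC -lerBrDr HN' ?leq_maxr.
- move=> [n _ /=]; rewrite in_itv/= => /andP[nx xn].
  have n0 : 0 < n.+1%:R^-1 :> R by rewrite invr_gt0.
  by rewrite (lt_le_trans n0)//= (le_lt_trans xn)// ltrBlDr ltrDl.
Qed.

Lemma itv0y_bigcup (R : realType) :
  `]0, +oo[%classic = \bigcup_n `[n.+1%:R^-1, n.+1%:R]%classic :> set R.
Proof.
apply/seteqP; split => x /=; rewrite ?in_itv/= ?andbT.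
- move=> x0; have [N HN] := invS_le_eventually _ _ x0.
  exists (maxn N (Num.bound x)) => //=; rewrite in_itv/= HN ?leq_maxl//=.
  apply/ltW/(lt_le_trans (archi_boundP (ltW x0))); rewrite ler_nat.
  by rewrite ltnW// ltnS leq_maxr.
- move=> [n _ /=]; rewrite in_itv/= => /andP[nx xn].
  by apply: lt_le_trans nx; rewrite invr_gt0.
Qed.

Lemma integrable_beta (R : realType) (a b : R) : 0 < a -> 0 < b ->
  (@lebesgue_measure R).-integrable `]0, 1[
    (EFin \o (fun t => t `^ (a - 1) * (1 - t) `^ (b - 1))).
Proof.
move=> a0 b0.
(* The factor 1 is the derivative of the identity, which plays the part of [X] here. *)
have -> : EFin \o (fun t : R => t `^ (a - 1) * (1 - t) `^ (b - 1)) =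
    EFin \o (fun t : R => t `^ (a - 1) * (1 - t) `^ (b - 1) * 1).
  by apply/funext => t /=; rewrite mulr1.
have vi : nondecreasing_seq (fun n => 1 - n.+1%:R^-1 : R).
  by move=> m n mn; rewrite lerB// nonincreasing_invS.
apply: (integrable_beta_comp _ _ _ id (fun=> 1) _ _ _ a0 b0
  (nonincreasing_invS R) vi (itv01_bigcup R)) => //.
- move=> x /=; rewrite in_itv/= => x01; split => //.
  by exact: cst_continuous.
  exact: is_derive_id.
Qed.

Lemma betaf_gt0 (R : realType) (a b : R) : 0 < a -> 0 < b -> 0 < betaf a b.
Proof.
move=> a0 b0; apply: Rintegral_itvoo_gt0.
- by rewrite bnd_simp.
- exact: integrable_beta.
- move=> x; rewrite in_itv/= => /andP[x0 x1].
  by rewrite mulr_gt0// powR_gt0// subr_gt0.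
Qed.

(** * Positivity and integrability of the RSB density *)

Lemma pi_rsb_gt0 (R : realType) (a b u : R) : 0 < a -> 0 < b -> 0 < u ->
  0 < pi_rsb a b u.
Proof.
move=> a0 b0 u0; have L0 : 0 < ln (1 + u) by rewrite ln_gt0// ltrDl.
rewrite /pi_rsb !divr_gt0 ?mulr_gt0 ?powR_gt0 ?invr_gt0 ?betaf_gt0//.
- by rewrite addr_gt0.
- by rewrite addr_gt0.
Qed.

(* Here [X] is [L / (1 + L)], and the last factor is its derivative in [u]. *)
Lemma rsb_beta_comp (R : realType) (a b u : R) : 0 < u ->
  let L := ln (1 + u) in let X := 1 - (1 + L) `^ (-1) in
  L `^ (a - 1) / (1 + u) / (1 + L) `^ (a + b) =
  X `^ (a - 1) * (1 - X) `^ (b - 1) * ((1 + L) `^ (-1 - 1) / (1 + u)).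
Proof.
move=> u0 L X; have L0 : 0 < L by rewrite ln_gt0// ltrDl.
have L1 : 0 < 1 + L by rewrite addr_gt0.
have XE : X = L * (1 + L) `^ (-1).
  by rewrite /X powR_inv1 ?ltW//; field; rewrite gt_eqF.
have -> : 1 - X = (1 + L) `^ (-1) by rewrite /X; ring.
rewrite XE powRM ?powR_ge0 ?(ltW L0)// -!powRrM -powRN.
(* The exponent of [1 + L] is shared out between the [X] power, the [1 - X] power and the derivative
   of [X]. *)
have -> : - (a + b) = -1 * (a - 1) + (-1 * (b - 1) + (-1 - 1)) by ring.
have powD r s : (1 + L) `^ (r + s) = (1 + L) `^ r * (1 + L) `^ s.
  by rewrite powRD// (gt_eqF L1) implybT.
by rewrite !powD; ring.
Qed.

(** Since [exp (- lam * u) <= 1] for [u > 0], the integrand is dominated by the density itself,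
    which is a constant multiple of a beta integrand composed with [X], a map from the half-line
    into the unit interval. *)
Lemma integrable_rsb (R : realType) (a b lam : R) : 0 < a -> 0 < b -> 0 <= lam ->
  (@lebesgue_measure R).-integrable `]0, +oo[
    (EFin \o (fun u => expR (- lam * u) * pi_rsb a b u)).
Proof.
move=> a0 b0 lam0; pose L (u : R) := ln (1 + u).
pose X u := 1 - (1 + L u) `^ (-1); pose X' u := (1 + L u) `^ (-1 - 1) / (1 + u).
have mL : measurable_fun setT L.
  apply: (measurableT_comp (@measurable_ln R)); exact: measurable_funD.
have mL1 c : measurable_fun setT (fun u => (1 + L u) `^ c).
  apply: (measurableT_comp (measurable_powR c)); exact: measurable_funD.
have mX : measurable_fun setT X by apply: measurable_funB.
have mX' : measurable_fun (`]0, +oo[%classic : set R) X'.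
  (* The inverse of [1 + u] is replaced by a real power, whose measurability is at hand; the two
     agree for [u > 0]. *)
  apply: (@eq_measurable_fun _ _ _ _ _ (fun u => (1 + L u) `^ (-1 - 1) * (1 + u) `^ (-1))).
    move=> u; rewrite inE/= in_itv/= andbT => u0.
    by rewrite powR_inv1// addr_ge0// ltW.
  apply: measurable_funTS; apply: measurable_funM => //.
  apply: (measurableT_comp (measurable_powR _)); exact: measurable_funD.
have intX : lebesgue_measure.-integrable `]0, +oo[
    (EFin \o (fun x => X x `^ (a - 1) * (1 - X x) `^ (b - 1) * X' x)).
  have vi : nondecreasing_seq (fun n => n.+1%:R : R).
    by move=> m n mn; rewrite ler_nat.
  apply: (integrable_beta_comp _ _ _ X X' _ _ _ a0 b0
    (nonincreasing_invS R) vi (itv0y_bigcup R)) => //.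
  - move=> u /=; rewrite in_itv/= andbT => u0.
    have u1 : 0 < 1 + u by rewrite addr_gt0.
    have L0 : 0 < L u by rewrite ln_gt0// ltrDl.
    have L1 : 0 < 1 + L u by rewrite addr_gt0.
    have dL1 : is_derive u 1 (fun u => 1 + L u) (1 + u)^-1.
      have d1 : is_derive u 1 (fun u : R => 1 + u) 1.
        by rewrite -[X in is_derive _ _ _ X]add0r; exact: is_deriveD.
      have dL := @is_derive1_comp _ (@ln R) (fun u => 1 + u) u _ _ (is_derive1_ln u1) d1.
      rewrite -[X in is_derive _ _ _ X]add0r; apply: is_deriveD.
      by rewrite mulr1 in dL.
    have dpow c := @is_derive1_comp _ (@powR R ^~ c) (fun u => 1 + L u) u _ _
      (is_derive1_powR c L1) dL1.
    split.
    + have : 1 < (1 + L u) by rewrite ltrDl.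
      rewrite /X powR_inv1 ?(ltW L1)// => L11.
      by rewrite subr_gt0 invf_lt1// L11/= ltrBlDr ltrDl invr_gt0.
    + by rewrite divr_ge0 ?powR_ge0// ltW.
    + apply: continuousM.
        have [d _] := dpow (-1 - 1); apply: differentiable_continuous.
        exact/derivable1_diffP.
      apply: continuousV; first by rewrite gt_eqF.
      by apply: continuousD => //; exact: cst_continuous.
    + have -> : X' u = 0 - (-1 * (1 + L u) `^ (-1 - 1) * (1 + u)^-1).
        by rewrite /X'; ring.
      exact: is_deriveB (dpow (-1)).
  - exact: measurable_funTS.
have mI : measurable (`]0, +oo[%classic : set R) by exact: measurable_itv.
apply: le_integrable (integrableZl (mu := lebesgue_measure) mI (betaf a b)^-1 intX) => //.
  apply/measurable_EFinP; apply: (@eq_measurable_fun _ _ _ _ _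
      (fun u => expR (- lam * u) * ((betaf a b)^-1 *
        (X u `^ (a - 1) * (1 - X u) `^ (b - 1) * X' u)))).
    move=> u; rewrite inE/= in_itv/= andbT => u0.
    by rewrite -rsb_beta_comp// /pi_rsb; congr (_ * _); rewrite -/(L u); ring.
  apply: measurable_funM.
    apply: measurable_funTS; apply: (measurableT_comp (@measurable_expR R)).
    exact: measurable_funM.
  apply: measurable_funM => //; apply/measurable_EFinP.
  exact: (measurable_int lebesgue_measure intX).
move=> u; rewrite /= in_itv/= andbT => u0.
rewrite lee_fin -rsb_beta_comp//.
have -> : (betaf a b)^-1 * (ln (1 + u) `^ (a - 1) / (1 + u) / (1 + ln (1 + u)) `^ (a + b)) =
  pi_rsb a b u by rewrite /pi_rsb; ring.
rewrite normrM ler_piMl// ger0_norm ?expR_ge0// expR_le1 mulNr oppr_le0.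
by rewrite mulr_ge0// ltW.
Qed.

(** * Integrals against the prior, and monotonicity in lambda *)

Lemma intF_split (R : realType) (s a b lam eps : R) : 0 < a -> 0 < b ->
  0 <= lam -> 0 < eps ->
  intF s a b lam `]0, +oo[ = intF s a b lam `]0, eps[ + intF s a b lam `[eps, +oo[.
Proof.
move=> a0 b0 lam0 eps0.
have U : `]0, +oo[%classic = `]0, eps[ `|` `[eps, +oo[ :> set R.
  by rewrite -itv_bndbnd_setU// bnd_simp.
have dI : [disjoint (`]0, eps[%classic : set R) & `[eps, +oo[%classic].
  apply/disj_setPRL => x /=; rewrite !in_itv/= andbT => xe /andP[_].
  by rewrite ltNge xe.
have eI : `[eps, +oo[%classic `&` `]0, +oo[%classic = `[eps, +oo[%classic :> set R.
  by apply: setIidl; apply: subset_itvr; rewrite bnd_simp.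
have eI' : `]0, eps[%classic `&` `]0, +oo[%classic = `]0, eps[%classic :> set R.
  by apply: setIidl; apply: subset_itvl; rewrite bnd_simp.
have intU := integrable_rsb _ _ _ _ a0 b0 lam0.
rewrite /intF setIid eI eI' {2}U Rintegral_setU -?U//.
(* The atom at 1 falls in exactly one of the two pieces: the left one if [1 < eps], the right one
   otherwise. *)
have -> : \1_(`]0, +oo[%classic : set R) (1 : R) =
    \1_(`]0, eps[%classic : set R) (1 : R) + \1_(`[eps, +oo[%classic : set R) (1 : R) :> R.
  rewrite !indicE !mem_setE !in_itv/= (@ltr01 R) !andbT/=.
  by case: (ltP 1 eps); rewrite ?addr0 ?add0r.
ring.
Qed.

Lemma intF_ge0 (R : realType) (s a b lam : R) (D : set R) :
  0 <= s -> s <= 1 -> 0 < a -> 0 < b -> 0 <= intF s a b lam D.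
Proof.
move=> s0 s1 a0 b0; rewrite addr_ge0// mulr_ge0 ?subr_ge0 ?mulr_ge0 ?expR_ge0//.
apply: Rintegral_ge0 => u [_ /=]; rewrite in_itv/= andbT => u0.
by rewrite mulr_ge0 ?expR_ge0//; exact/ltW/pi_rsb_gt0.
Qed.

(** The pointwise inequality is integrated against the density, and taken at [u = 1] for the atom if
    [D] contains 1. Constants on both sides let the same lemma bound the mass below [eps] from below
    and the mass above it from above. *)
Lemma le_intF (R : realType) (s a b c1 c2 l1 l2 : R) (D : set R) :
  0 <= s -> s <= 1 -> 0 < a -> 0 < b -> 0 <= l1 -> 0 <= l2 ->
  measurable D ->
  (forall u, D u -> c1 * expR (- l1 * u) <= c2 * expR (- l2 * u)) ->
  c1 * intF s a b l1 D <= c2 * intF s a b l2 D.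
Proof.
move=> s0 s1 a0 b0 l10 l20 mD le12.
have mI : measurable (D `&` `]0, +oo[) by apply: measurableI.
have intD l : 0 <= l -> lebesgue_measure.-integrable (D `&` `]0, +oo[)
    (EFin \o (fun u => expR (- l * u) * pi_rsb a b u)).
  move=> l0; apply: (integrableS (mu := lebesgue_measure) _ mI (@subIsetr _ _ _)
    (integrable_rsb _ _ _ _ a0 b0 l0)).
  exact: measurable_itv.
rewrite /intF !mulrDr; apply: lerD.
  rewrite !mulrA ![_ * (1 - s)]mulrC -!mulrA ler_wpM2l ?subr_ge0//.
  rewrite indicE; have [/set_mem/le12|_] := boolP (1 \in D).
    by rewrite !mul1r.
  by rewrite !mul0r !mulr0.
rewrite !mulrA ![_ * s]mulrC -!mulrA ler_wpM2l// -!RintegralZl ?intD//.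
apply: le_Rintegral => //.
- exact: (integrableZl (mu := lebesgue_measure) mI c1 (intD _ l10)).
- exact: (integrableZl (mu := lebesgue_measure) mI c2 (intD _ l20)).
- move=> u [/le12 lu /=]; rewrite in_itv/= andbT => u0.
  rewrite mulrA [leRHS]mulrA; apply: ler_wpM2r; last exact: lu.
  exact/ltW/pi_rsb_gt0.
Qed.

(** The atom contributes a nonnegative amount and may be missed by the interval, so strict
    positivity comes from the density part, through [0 < s]. *)
Lemma intF_gt0 (R : realType) (s a b lam : R) (q : itv_bound R) :
  (BRight 0 < q)%O -> 0 < s -> s <= 1 -> 0 < a -> 0 < b -> 0 <= lam ->
  0 < intF s a b lam [set` Interval (BRight 0) q].
Proof.
move=> q0 s0 s1 a0 b0 lam0.
have qS : [set` Interval (BRight 0) q] `<=` `]0, +oo[.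
  move=> x /=; rewrite !in_itv/= andbT; by case/andP.
rewrite /intF (setIidl qS) ltr_wpDl// ?mulr_ge0 ?subr_ge0 ?expR_ge0//.
rewrite mulr_gt0//; apply: Rintegral_itvoo_gt0 => //.
  by apply: (integrableS (mu := lebesgue_measure) _ _ qS
    (integrable_rsb _ _ _ _ a0 b0 lam0)); exact: measurable_itv.
move=> x /qS/=; rewrite in_itv/= andbT => x0.
by rewrite mulr_gt0 ?expR_gt0 ?pi_rsb_gt0.
Qed.

Lemma post_homo (R : realType) (s a b eps l1 l2 : R) :
  0 < a -> 0 < b -> 0 < s -> s <= 1 -> 0 < eps -> 0 <= l1 -> l1 <= l2 ->
  post s a b eps l1 <= post s a b eps l2.
Proof.
move=> a0 b0 s0 s1 eps0 l10 l12; have l20 := le_trans l10 l12.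
pose q := expR (- (l2 - l1) * eps).
have tiltE u : expR (- l2 * u) = expR (- (l2 - l1) * u) * expR (- l1 * u).
  by rewrite -expRD; congr expR; ring.
have N0 l : 0 <= l -> 0 < intF s a b l `]0, eps[ by move=> ?; apply: intF_gt0.
have D0 l : 0 <= l -> 0 < intF s a b l `]0, +oo[ by move=> ?; apply: intF_gt0.
have Nle : q * intF s a b l1 `]0, eps[ <= 1 * intF s a b l2 `]0, eps[.
  apply: le_intF => //; try exact: ltW.
  move=> u /=; rewrite in_itv/= => /andP[u0 ue].
  rewrite mul1r tiltE ler_wpM2r ?expR_ge0// ler_expR !mulNr lerN2.
  by rewrite ler_wpM2l ?subr_ge0// ltW.
have Tle : 1 * intF s a b l2 `[eps, +oo[ <= q * intF s a b l1 `[eps, +oo[.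
  apply: le_intF => //; try exact: ltW.
  move=> u /=; rewrite in_itv/= andbT => ue.
  rewrite mul1r tiltE ler_wpM2r ?expR_ge0// ler_expR !mulNr lerN2.
  by rewrite ler_wpM2l ?subr_ge0.
have T10 : 0 <= intF s a b l1 `[eps, +oo[ by apply: intF_ge0 => //; exact: ltW.
rewrite /post ler_pdivrMr ?D0// mulrAC ler_pdivlMr ?D0//.
(* Write [N1], [N2] for the masses below [eps] and [T1], [T2] for those above. After
   cross-multiplication, [N1 * N2] is on both sides, and what remains is
   [N1 * T2 <= q * N1 * T1 <= N2 * T1]. *)
rewrite !(intF_split _ s a b _ eps)// [leLHS]mulrDr [leRHS]mulrDr [leLHS]addrC [leRHS]addrC.
rewrite !mul1r in Nle Tle.
apply: lerD; last by rewrite mulrC.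
apply: (le_trans (ler_wpM2l (ltW (N0 _ l10)) Tle)).
by rewrite mulrCA mulrA ler_wpM2r.
Qed.

(** * Behaviour of the posterior ratio near zero *)

(** With [L = ln (1 + u)], the quotient of the densities for [a] and [a'] is a constant times
    [L ^ (a - a') * (1 + L) ^ (a' - a)]. The last factor is at least 1, so it is enough that
    [L ^ (a' - a)] be small, which follows from [L <= u]. *)
Lemma pi_rsb_dominates (R : realType) (a a' b K : R) :
  0 < a -> 0 < b -> a < a' -> 0 < K ->
  exists2 d, 0 < d & forall u, 0 < u < d -> K * pi_rsb a' b u <= pi_rsb a b u.
Proof.
move=> a0 b0 aa' K0; have a'0 := lt_trans a0 aa'.
have B0 := betaf_gt0 _ _ _ a0 b0; have B'0 := betaf_gt0 _ _ _ a'0 b0.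
(* Largest value of [L ^ (a' - a)] for which [K] and the two beta constants are absorbed; its root
   of order [a' - a] is the radius [d]. *)
pose k := betaf a' b / (K * betaf a b).
have k0 : 0 < k by rewrite divr_gt0// mulr_gt0.
have c0 : 0 < a' - a by rewrite subr_gt0.
exists (k `^ (a' - a)^-1); first exact: powR_gt0.
move=> u /andP[u0 ud].
set L := ln (1 + u); have L0 : 0 < L by rewrite ln_gt0// ltrDl.
have Lu : L <= u by rewrite le_ln1Dx// (lt_trans _ u0)// oppr_lt0.
have Lk : L `^ (a' - a) <= k.
  rewrite -[leRHS]powRr1; last exact: ltW k0.
  rewrite -(mulVf (lt0r_neq0 c0)) powRrM.
  apply: ge0_ler_powR; rewrite ?nnegrE ?powR_ge0 ?(ltW c0) ?(ltW L0)//.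
  exact: le_trans (ltW ud).
have KLk : K * (betaf a' b)^-1 * L `^ (a' - a) <= (betaf a b)^-1.
  apply: (@le_trans _ _ (K * (betaf a' b)^-1 * k)).
    by rewrite ler_wpM2l// divr_ge0 ?ltW.
  by rewrite /k le_eqVlt; apply/orP; left; apply/eqP; field; rewrite !gt_eqF.
rewrite /pi_rsb -/L.
have -> : L `^ (a' - 1) = L `^ (a' - a) * L `^ (a - 1).
  rewrite -powRD; first by congr (_ `^ _); ring.
  by rewrite (gt_eqF L0) implybT.
rewrite !mulrA; apply: ler_pM.
- by rewrite !mulr_ge0 ?powR_ge0 ?invr_ge0 ?addr_ge0 ?ltW.
- by rewrite invr_ge0 powR_ge0.
- by rewrite ler_wpM2r ?invr_ge0 ?addr_ge0 ?(ltW u0)// ler_wpM2r ?powR_ge0.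
- rewrite lef_pV2 ?posrE ?powR_gt0 ?addr_gt0//.
  by apply: ler_powR; [rewrite lerDl ltW|rewrite lerD2r ltW].
Qed.

Lemma post_ratio_cvgy (R : realType) (a a' b s lam : R) :
  0 < a -> 0 < b -> a < a' -> 0 < s -> s <= 1 -> 0 <= lam ->
  (fun eps => post s a b eps lam / post s a' b eps lam) @ 0^'+ --> +oo.
Proof.
move=> a0 b0 aa' s0 s1 lam0; have a'0 := lt_trans a0 aa'.
apply/cvgryPge => A.
set D := intF s a b lam `]0, +oo[; set D' := intF s a' b lam `]0, +oo[.
have D0 : 0 < D by apply: intF_gt0.
have D'0 : 0 < D' by apply: intF_gt0.
(* The target [A] may be negative, whereas the domination constant must be positive. The factor
   [D / D'] below offsets the normalising integrals, which do not depend on [eps]. *)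
pose M := Num.max A 1; have M0 : 0 < M by rewrite /M lt_max ltr01 orbT.
have [d d0 Hd] := @pi_rsb_dominates _ a a' b (M * (D / D')) a0 b0 aa'
  (mulr_gt0 M0 (divr_gt0 D0 D'0)).
near=> eps.
have eps0 : 0 < eps by near: eps; exact: nbhs_right_gt.
have epsd : eps < d by near: eps; exact: nbhs_right_lt.
have eps1 : eps < 1 by near: eps; exact: nbhs_right_lt.
apply: (@le_trans _ _ M); first by rewrite /M le_max lexx.
rewrite /post -/D -/D'.
set N := intF s a b _ _; set N' := intF s a' b _ _.
have N'0 : 0 < N' by apply: intF_gt0.
suff NN' : M * (D / D') * N' <= N.
  have -> : M = M * (D / D') * N' / D / (N' / D') by field; rewrite !gt_eqF.
  rewrite ler_wpM2r ?invr_ge0 ?divr_ge0 ?(ltW N'0) ?(ltW D'0)//.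
  by rewrite ler_wpM2r ?invr_ge0 ?(ltW D0).
have eS : (`]0, eps[%classic : set R) `<=` `]0, +oo[%classic.
  by apply: subset_itvl; rewrite bnd_simp.
have mE : measurable (`]0, eps[%classic : set R) by exact: measurable_itv.
have mI : measurable (`]0, +oo[%classic : set R) by exact: measurable_itv.
have intE c : 0 < c -> lebesgue_measure.-integrable `]0, eps[
    (EFin \o (fun u => expR (- lam * u) * pi_rsb c b u)).
  move=> c0; exact: (integrableS (mu := lebesgue_measure) mI mE eS
    (integrable_rsb _ _ _ _ c0 b0 lam0)).
(* With the atom outside []0, eps[], both numerators are [s] times a density integral; [s] cancels
   and the densities can be compared pointwise. *)
have d1 : \1_(`]0, eps[) 1 = 0 :> R.
  by rewrite indicE memNset//= in_itv/= ltr01/= ltNge (ltW eps1).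
rewrite /N /N' /intF (setIidl eS) d1 !mul0r !mulr0 !add0r.
rewrite mulrCA ler_pM2l// -RintegralZl ?intE//.
apply: le_Rintegral => //.
- exact: (integrableZl (mu := lebesgue_measure) mE _ (intE _ a'0)).
- exact: intE.
- move=> u /=; rewrite in_itv/= => /andP[u0 ue].
  by rewrite mulrCA ler_wpM2l ?expR_ge0// Hd// u0 (lt_trans ue).
Unshelve. all: by end_near. Qed.

Theorem theorem2 (R : realType) (a b : R) (ha : 0 < a) (hb : 0 < b) :
  (forall s : R, 0 < s -> s < 1 ->
     forall eps : R, 0 < eps ->
       forall l1 l2 : R, 0 < l1 -> l1 <= l2 ->
         post s a b eps l1 <= post s a b eps l2)
  /\
  (forall a' s : R, a < 1 -> 1 < a' -> 0 < s -> s <= 1 ->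
     forall lam : R, 0 < lam ->
       (fun eps => post s a b eps lam / post s a' b eps lam) @ 0^'+ --> +oo).
Proof.
split.
- by move=> s s0 s1 eps eps0 l1 l2 l10; apply: post_homo => //; exact: ltW.
- move=> a' s a1 a'1 s0 s1 lam lam0.
  by apply: post_ratio_cvgy => //; [exact: lt_trans a1 a'1|exact: ltW].
Qed.
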